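(* Let $M\in\mathbb{C}^{p\times p}$ be invertible and let $\mathcal{A}\in\mathbb{C}^{m\times n\times p}$ have multirank $\mathrm{rank}_M(\mathcal{A})=(r,r,\ldots,r)$. If $\mathcal{A}=\mathcal{S}*_M\mathcal{T}$ is a full-rank decomposition of $\mathcal{A}$, then $$\mathcal{A}^{\dagger}=\mathcal{T}^{*}*_M(\mathcal{S}^{*}*_M\mathcal{A}*_M\mathcal{T}^{*})^{-1}*_M\mathcal{S}^{*}.$$
   Context: For $\mathcal{A}\in\mathbb{C}^{m\times n\times p}$ and an invertible $M\in\mathbb{C}^{p\times p}$, let $\tilde{\mathcal{A}}=\mathcal{A}\times_3 M$, i.e. $\tilde{\mathcal{A}}(i,j,k)=\sum_{l=1}^p M(k,l)\,\mathcal{A}(i,j,l)$. The $k$-th frontal slice of $\tilde{\mathcal{A}}$ is the matrix $\tilde{\mathcal{A}}(:,:,k)$. M-product: for $\mathcal{A}\in\mathbb{C}^{m\times n\times p}$ and $\mathcal{B}\in\mathbb{C}^{n\times q\times p}$, $\mathcal{A}*_M\mathcal{B}\in\mathbb{C}^{m\times q\times p}$ is the unique tensor $\mathcal{C}$ with $\tilde{\mathcal{C}}(:,:,k)=\tilde{\mathcal{A}}(:,:,k)\tilde{\mathcal{B}}(:,:,k)$ for all $k=1,\ldots,p$. Conjugate transpose: $\mathcal{A}^*\in\mathbb{C}^{n\times m\times p}$ is the tensor with $\widetilde{\mathcal{A}^*}(:,:,k)=(\tilde{\mathcal{A}}(:,:,k))^*$ for all $k$. A tensor $\mathcal{A}\in\mathbb{C}^{n\times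 n\times p}$ is invertible (with respect to $*_M$) if every frontal slice of $\tilde{\mathcal{A}}$ is an invertible matrix; the inverse $\mathcal{A}^{-1}$ then satisfies $\widetilde{\mathcal{A}^{-1}}(:,:,k)=(\tilde{\mathcal{A}}(:,:,k))^{-1}$. Multirank: $\mathrm{rank}_M(\mathcal{A})=(r_1,\ldots,r_p)$ with $r_k=\mathrm{rank}(\tilde{\mathcal{A}}(:,:,k))$. Tubal rank: $\mathrm{rank}_t(\mathcal{A})=\max_k r_k$. Full-rank decomposition (FRD): if $\mathrm{rank}_t(\mathcal{A})=r$, then $\mathcal{A}=\mathcal{S}*_M\mathcal{T}$ is an FRD of $\mathcal{A}$ when $\mathcal{S}\in\mathbb{C}^{m\times r\times p}$, $\mathcal{T}\in\mathbb{C}^{r\times n\times p}$ and $\mathrm{rank}_t(\mathcal{S})=r=\mathrm{rank}_t(\mathcal{T})$. Moore-Penrose inverse: $\mathcal{A}^{\dagger}\in\mathbb{C}^{n\times m\times p}$ is the unique tensor $\mathcal{Z}$ with $\mathcal{A}*_M\mathcal{Z}*_M\mathcal{A}=\mathcal{A}$, $\mathcal{Z}*_M\mathcal{A}*_M\mathcal{Z}=\mathcal{Z}$, $(\mathcal{A}*_M\mathcal{Z})^*=\mathcal{A}*_M\mathcal{Z}$, $(\mathcal{Z}*_M\mathcal{A})^*=\mathcal{Z}*_M\mathcal{A}$. The asserted identity includes the assertion that the inverse appearing in it exists. *)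

(* Defs.v *)
From HB Require Import structures.
From mathcomp Require Import all_boot all_order all_algebra.

Set Implicit Arguments.
Unset Strict Implicit.
Unset Printing Implicit Defensive.

Import GRing.Theory Num.Theory.
Local Open Scope ring_scope.
Local Open Scope sesquilinear_scope.

(* A tensor is the family of its frontal slices: the entry (i, j, k) of A is
   A k i j. *)
Notation tensor C m n p := {ffun 'I_p -> 'M[C]_(m, n)}.

Section MProduct.
Variables (C : numClosedFieldType) (p : nat) (M : 'M[C]_p).

Definition mode3 (m n : nat) (A : tensor C m n p) (N : 'M[C]_p) :
    tensor C m n p :=
  [ffun k => \matrix_(i, j) \sum_(l < p) N k l * A l i j].

Definition hat (m n : nat) (A : tensor C m n p) : tensor C m n p := mode3 A M.

(* The inverse of [hat] when M is invertible, see [hatK] and [unhatK]. *)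
Definition unhat (m n : nat) (A : tensor C m n p) : tensor C m n p :=
  mode3 A (invmx M).

(* The next three operations are meaningful for M invertible; they are then
   characterized slice by slice in [mprodP], [tadjP] and [tinvP]. *)
Definition mprod (m n q : nat) (A : tensor C m n p) (B : tensor C n q p) :
    tensor C m q p :=
  unhat [ffun k => hat A k *m hat B k].

Definition tadj (m n : nat) (A : tensor C m n p) : tensor C n m p :=
  unhat [ffun k => (hat A k)^t*].

Definition tinvertible (n : nat) (A : tensor C n n p) : Prop :=
  forall k, hat A k \in unitmx.

(* Only meaningful under [tinvertible A], as [invmx] is total. *)
Definition tinv (n : nat) (A : tensor C n n p) : tensor C n n p :=
  unhat [ffun k => invmx (hat A k)].

Definition multirank (m n : nat) (A : tensor C m n p) : {ffun 'I_p -> nat} :=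
  [ffun k => \rank (hat A k)].

Definition tubal_rank (m n : nat) (A : tensor C m n p) : nat :=
  \max_(k < p) multirank A k.

Definition full_rank_decomposition (m n r : nat) (A : tensor C m n p)
    (S : tensor C m r p) (T : tensor C r n p) : Prop :=
  [/\ tubal_rank A = r, A = mprod S T, tubal_rank S = r & tubal_rank T = r].

Definition penrose (m n : nat) (A : tensor C m n p) (Z : tensor C n m p) :
    Prop :=
  [/\ mprod (mprod A Z) A = A,
      mprod (mprod Z A) Z = Z,
      tadj (mprod A Z) = mprod A Z
    & tadj (mprod Z A) = mprod Z A].

(* Z is the Moore-Penrose inverse of A, i.e. the unique solution of the Penrose
   equations; [unique] includes the fact that Z is a solution. *)
Definition is_mpinv (m n : nat) (A : tensor C m n p) (Z : tensor C n m p) :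
    Prop :=
  unique (penrose A) Z.

Lemma mode3M (m n : nat) (A : tensor C m n p) (N1 N2 : 'M[C]_p) :
  mode3 (mode3 A N1) N2 = mode3 A (N2 *m N1).
Proof.
apply/ffunP=> k; apply/matrixP=> i j; rewrite !ffunE !mxE.
under eq_bigr => l _ do rewrite ffunE mxE mulr_sumr.
rewrite exchange_big /=; apply: eq_bigr => l _.
by rewrite mxE mulr_suml; apply: eq_bigr => s _; rewrite mulrA.
Qed.

Lemma mode3_1 (m n : nat) (A : tensor C m n p) : mode3 A 1%:M = A.
Proof.
apply/ffunP=> k; apply/matrixP=> i j; rewrite !ffunE !mxE.
rewrite (bigD1 k) //= mxE eqxx mul1r big1 ?addr0 // => l /negPf nlk.
by rewrite mxE eq_sym nlk mul0r.
Qed.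

Hypothesis uM : M \in unitmx.

Lemma hatK (m n : nat) : cancel (@hat m n) (@unhat m n).
Proof. by move=> A; rewrite /unhat /hat mode3M mulVmx // mode3_1. Qed.

Lemma unhatK (m n : nat) : cancel (@unhat m n) (@hat m n).
Proof. by move=> A; rewrite /unhat /hat mode3M mulmxV // mode3_1. Qed.

Lemma unhatP (m n : nat) (F : 'I_p -> 'M[C]_(m, n)) (X : tensor C m n p) :
  X = unhat (finfun F) <-> forall k, hat X k = F k.
Proof.
split=> [-> k|hX]; first by rewrite unhatK ffunE.
by rewrite -[X]hatK; congr unhat; apply/ffunP=> k; rewrite hX ffunE.
Qed.

Lemma mprodP (m n q : nat) (A : tensor C m n p) (B : tensor C n q p)
    (X : tensor C m q p) :
  X = mprod A B <-> forall k, hat X k = hat A k *m hat B k.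
Proof. exact: unhatP. Qed.

Lemma tadjP (m n : nat) (A : tensor C m n p) (X : tensor C n m p) :
  X = tadj A <-> forall k, hat X k = (hat A k)^t*.
Proof. exact: unhatP. Qed.

Lemma tinvP (n : nat) (A X : tensor C n n p) :
  X = tinv A <-> forall k, hat X k = invmx (hat A k).
Proof. exact: unhatP. Qed.

End MProduct.

(* Main.v *)
Require Import Defs.
From HB Require Import structures.
From mathcomp Require Import all_boot all_order all_algebra.
From mathcomp Require Import reals complex.

Set Implicit Arguments.
Unset Strict Implicit.
Unset Printing Implicit Defensive.

Import GRing.Theory Num.Theory.
Local Open Scope ring_scope.
Local Open Scope complex_scope.

(** The map [hat] is injective when [M] is invertible and turns the M-product,
    the conjugate transpose and the inverse of tensors into the corresponding
    matrix operations on each frontal slice.  Both claims of the theorem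
    are therefore statements about one slice at a time ([penroseP]).

    In a slice, [A = S *m T] has rank [r], which is also the inner dimension of
    the product, so [S] has full column rank and [T] full row rank.  Over the
    complex numbers this makes the Gram matrices [G = S^t* *m S] and
    [H = T *m T^t*] invertible ([gram_unitmx]), because [v *m X *m X^t* = 0]
    forces [v *m X] to have norm zero.  Hence [S^t* *m A *m T^t* = G *m H] is
    invertible and the candidate is
    [Z = P *m Q], where [P = T^t* *m invmx H] is a right inverse of [T] and
    [Q = invmx G *m S^t*] a left inverse of [S].  It follows that
    [A *m Z = S *m invmx G *m S^t*] and [Z *m A = T^t* *m invmx H *m T]; both are
    Hermitian and the four Penrose equations are immediate
    ([mx_penrose_full_rank]).  Uniqueness is Penrose's argument
    ([mx_penrose_inj]): the products [A *m Z] and [Z *m A] do not depend on the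
    solution [Z], and they determine [Z]. *)

(** * Conjugate transposes and Gram matrices *)

Section MoorePenrose.
Variable C : numClosedFieldType.
Local Open Scope sesquilinear_scope.

Lemma trmxC_mul (m n q : nat) (A : 'M[C]_(m, n)) (B : 'M[C]_(n, q)) :
  (A *m B)^t* = B^t* *m A^t*.
Proof. by rewrite trmx_mul map_mxM. Qed.

Lemma trmxC_inv (n : nat) (A : 'M[C]_n) : (invmx A)^t* = invmx (A^t*).
Proof. by rewrite trmx_inv map_invmx. Qed.

Lemma mxrank_trmxC (m n : nat) (A : 'M[C]_(m, n)) : \rank (A^t*) = \rank A.
Proof. by rewrite mxrank_map mxrank_tr. Qed.

Lemma gram_herm (m n : nat) (X : 'M[C]_(m, n)) :
  (X *m X^t*)^t* = X *m X^t*.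
Proof. by rewrite trmxC_mul trmxCK. Qed.

(** If [v] kills [X *m X^t*], then [v *m X] has inner product zero with itself,
    hence vanishes by positive definiteness, and [v = 0] by independence of the
    rows of [X]. *)
Lemma gram_unitmx (m n : nat) (X : 'M[C]_(m, n)) :
  row_free X -> X *m X^t* \in unitmx.
Proof.
move=> freeX; rewrite -row_free_unit; apply: inj_row_free => v vXX0.
apply/eqP; rewrite -(mulmx_free_eq0 _ freeX) -(dnorm_eq0 (@dotmx C n)).
apply/eqP/(etrans (dotmxE _ _)).
by rewrite trmxC_mul mulmxA -(mulmxA v) vXX0 mul0mx mxE.
Qed.

Lemma invmx_mul (n : nat) (A B : 'M[C]_n) :
  A \in unitmx -> B \in unitmx -> invmx (A *m B) = invmx B *m invmx A.
Proof.
move=> uA uB; have uAB : A *m B \in unitmx by rewrite unitmx_mul uA.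
by rewrite -[RHS](mulKmx uAB) (mulmxA (A *m B)) mulmxK // mulmxV // mulmx1.
Qed.

(** * The Moore-Penrose inverse of a matrix *)

Definition mx_penrose (m n : nat) (A : 'M[C]_(m, n)) (Z : 'M[C]_(n, m)) :
    Prop :=
  [/\ A *m Z *m A = A, Z *m A *m Z = Z,
      (A *m Z)^t* = A *m Z & (Z *m A)^t* = Z *m A].

(** The product of Hermitian matrices [(A *m Y) *m (A *m X)] collapses to
    [A *m X], so its conjugate transpose [(A *m X) *m (A *m Y)], which collapses
    to [A *m Y], is also [A *m X]; the same holds on the other side, whence
    [X = X *m A *m X = Y *m A *m Y = Y]. *)
Lemma mx_penrose_inj (m n : nat) (A : 'M[C]_(m, n)) (X Y : 'M[C]_(n, m)) :
  mx_penrose A X -> mx_penrose A Y -> X = Y.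
Proof.
case=> AXA XAX hAX hXA [AYA YAY hAY hYA].
have eqAX : A *m X = A *m Y.
  by rewrite -hAX -[A in A *m X]AYA -mulmxA trmxC_mul hAX hAY mulmxA AXA.
have eqXA : X *m A = Y *m A.
  by rewrite -hXA -[A in X *m A]AYA -mulmxA mulmxA trmxC_mul hXA hYA -mulmxA
             (mulmxA A) AXA.
by rewrite -XAX -mulmxA eqAX mulmxA eqXA YAY.
Qed.

(** The rank of a product is at most that of each factor, and the inner dimension
    bounds the rank of each factor, so both bounds are attained.  Full column
    rank of [S] is stated as independence of the rows of [S^t*], the form in
    which [gram_unitmx] applies. *)
Lemma full_rank_factors (m n r : nat) (S : 'M[C]_(m, r)) (T : 'M[C]_(r, n)) :
  \rank (S *m T) = r -> row_free (S^t*) /\ row_free T.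
Proof.
move=> rkST; rewrite /row_free mxrank_trmxC; split; rewrite eqn_leq.
  by rewrite rank_leq_col -[leqLHS]rkST mxrankM_maxl.
by rewrite rank_leq_row -[leqLHS]rkST mxrankM_maxr.
Qed.

Section FullRank.
Variables (m n r : nat) (S : 'M[C]_(m, r)) (T : 'M[C]_(r, n)).
Hypotheses (freeS : row_free (S^t*)) (freeT : row_free T).

Let uG : S^t* *m S \in unitmx.
Proof. by rewrite -{2}[S]trmxCK gram_unitmx. Qed.

Let uH : T *m T^t* \in unitmx := gram_unitmx freeT.

Let midE : S^t* *m (S *m T) *m T^t* = (S^t* *m S) *m (T *m T^t*).
Proof. by rewrite !mulmxA. Qed.

Lemma full_rank_mid_unitmx : S^t* *m (S *m T) *m T^t* \in unitmx.
Proof. by rewrite midE unitmx_mul uG uH. Qed.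

Lemma mx_penrose_full_rank :
  mx_penrose (S *m T) (T^t* *m invmx (S^t* *m (S *m T) *m T^t*) *m S^t*).
Proof.
rewrite midE (invmx_mul uG uH).
set G := S^t* *m S; set H := T *m T^t*.
have hG : G^t* = G by rewrite /G trmxC_mul trmxCK.
set Z := _ *m S^t*.
have STZ : S *m T *m Z = S *m invmx G *m S^t*.
  by rewrite /Z !mulmxA -(mulmxA S T) -/H (mulmxK uH).
have ZST : Z *m (S *m T) = T^t* *m invmx H *m T.
  by rewrite /Z !mulmxA -(mulmxA _ _ S) -/G (mulmxKV uG).
split.
- by rewrite STZ mulmxA -(mulmxA _ _ S) -/G (mulmxKV uG).
- by rewrite ZST /Z !mulmxA -(mulmxA _ T) -/H (mulmxKV uH).
- by rewrite STZ !trmxC_mul trmxC_inv hG trmxCK mulmxA.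
- by rewrite ZST !trmxC_mul trmxC_inv gram_herm trmxCK mulmxA.
Qed.

End FullRank.

(** * Passing to the frontal slices *)

Section Slices.
Variables (p : nat) (M : 'M[C]_p).
Hypothesis uM : M \in unitmx.

Lemma hat_mprod (m n q : nat) (A : tensor C m n p) (B : tensor C n q p) k :
  hat M (mprod M A B) k = hat M A k *m hat M B k.
Proof. exact: (mprodP uM A B _).1. Qed.

Lemma hat_tadj (m n : nat) (A : tensor C m n p) k :
  hat M (tadj M A) k = (hat M A k)^t*.
Proof. exact: (tadjP uM A _).1. Qed.

Lemma hat_tinv (n : nat) (A : tensor C n n p) k :
  hat M (tinv M A) k = invmx (hat M A k).
Proof. exact: (tinvP uM A _).1. Qed.

Lemma eq_hat (m n : nat) (A B : tensor C m n p) :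
  A = B <-> forall k, hat M A k = hat M B k.
Proof.
by split=> [-> //|eqAB]; apply: (can_inj (@hatK _ _ _ uM m n)); apply/ffunP.
Qed.

Lemma penroseP (m n : nat) (A : tensor C m n p) (Z : tensor C n m p) :
  penrose M A Z <-> forall k, mx_penrose (hat M A k) (hat M Z k).
Proof.
split=> [[/eq_hat e1 /eq_hat e2 /eq_hat e3 /eq_hat e4] k|pZ].
  move: (e1 k) (e2 k) (e3 k) (e4 k).
  by rewrite !hat_tadj !hat_mprod.
by split; apply/eq_hat => k; have [] := pZ k; rewrite ?hat_tadj !hat_mprod.
Qed.

Lemma penrose_inj (m n : nat) (A : tensor C m n p) (X Y : tensor C n m p) :
  penrose M A X -> penrose M A Y -> X = Y.
Proof.
move=> /penroseP pX /penroseP pY; apply/eq_hat => k.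
exact: mx_penrose_inj (pX k) (pY k).
Qed.

End Slices.
End MoorePenrose.

Theorem theorem2p5 (R : realType) (m n p r : nat) (M : 'M[R[i]]_p)
    (A : tensor R[i] m n p) (S : tensor R[i] m r p) (T : tensor R[i] r n p)
    (uM : M \in unitmx)
    (rankA : multirank M A = [ffun=> r])
    (frd : full_rank_decomposition M A S T) :
  let W := mprod M (mprod M (tadj M S) A) (tadj M T) in
  tinvertible M W /\
  is_mpinv M A (mprod M (mprod M (tadj M T) (tinv M W)) (tadj M S)).
Proof.
case: frd => _ eqA _ _ W.
have hatA k : hat M A k = hat M S k *m hat M T k by rewrite eqA hat_mprod.
have factors k : row_free ((hat M S k)^t*)%sesqui /\ row_free (hat M T k).
  apply: full_rank_factors; rewrite -hatA.
  by move/ffunP/(_ k): rankA; rewrite !ffunE.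
have hatW k : hat M W k =
    ((hat M S k)^t* *m (hat M S k *m hat M T k) *m (hat M T k)^t*)%sesqui.
  by rewrite !hat_mprod // !hat_tadj // hatA.
split=> [k|]; first by have [? ?] := factors k; rewrite hatW full_rank_mid_unitmx.
have pZ : penrose M A (mprod M (mprod M (tadj M T) (tinv M W)) (tadj M S)).
  apply/penroseP => // k; have [? ?] := factors k.
  rewrite !hat_mprod // !hat_tadj // hat_tinv // hatW hatA.
  exact: mx_penrose_full_rank.
by split=> // Y pY; apply: (penrose_inj uM) pZ pY.
Qed.
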